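(* Let $d\ge2$, $\kappa,l>0$, $\lambda\in\mathbb R$, $k\in\{-1,0,1\}$ and $\mu\in\mathbb R$. On the open set of $(A,\phi)\in\mathbb R^2$ where the quantities under the square roots below are positive, define $$\pi_\phi(A,\phi)=\pm e^{dA}\sqrt{\frac{d(d-1)}{\kappa^2l^2}\mu e^{-(d+1)A}+k\Big(\frac{d-1}{2l}\Big)^2\phi^2e^{-2A}+\lambda\phi^{\frac{2(d+1)}{d-1}}},$$ $$\pi_A(A,\phi)=-\frac{d(d-1)}{\kappa^2l}e^{dA}\sqrt{1+ke^{-2A}+\mu e^{-(d+1)A}}+\frac{d-1}2\phi\,\pi_\phi(A,\phi).$$ Then (i) $\mathcal H(A,\phi,\pi_A(A,\phi),\pi_\phi(A,\phi))=0$ identically, where $$\mathcal H=\frac12\Big\{e^{-dA}\Big(\pi_\phi^2-\frac{\kappa^2}{d(d-1)}\big(\pi_A-\tfrac{d-1}2\phi\pi_\phi\big)^2\Big)+e^{dA}\Big(\frac{d(d-1)}{\kappa^2l^2}-\lambda\phi^{\frac{2(d+1)}{d-1}}+\frac{d(d-1)k}{\kappa^2l^2}e^{-2A}\big(1-\tfrac{(d-1)\kappa^2}{4d}\phi^2\big)\Big)\Big\};$$ (ii) $\partial\pi_A/\partial\phi=\partial\pi_\phi/\partial A$. Consequently, locally there is a function $\mathcal S(A,\phi)$ (depending on the arbitrary constant $\mu$) with $\pi_A=\partial_A\mathcal S$, $\pi_\phi=\partial_\phi\mathcal S$, which is a complete integral of the Hamilton–Jacobi equation $\mathcal H(A,\phi,\partial_A\mathcal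 S,\partial_\phi\mathcal S)=0$.
   Context: $\mathcal H$ is the radial Hamiltonian of the action $\int d^{d+1}x\sqrt g\big(-\frac{1}{2\kappa^2}(R+\frac{d(d-1)}{l^2})+\frac12(\partial\phi)^2+\frac{d-1}{8d}R\phi^2+\frac\lambda2\phi^{2(d+1)/(d-1)}\big)$ reduced to metrics $ds^2=dr^2+e^{2A(r)}g^{(0)}_{ij}dx^idx^j$ with $g^{(0)}$ of constant scalar curvature $kd(d-1)/l^2$ and $\phi=\phi(r)$; here $\pi_A$, $\pi_\phi$ are the momenta conjugate to $A$ and $\phi$. *)

(* Defs.v *)
From Stdlib Require Import Reals.
From Coquelicot Require Import Coquelicot.
Open Scope R_scope.

(* |x|^p, with the convention 0^p = 0 (p > 0 here). Used for phi^{2(d+1)/(d-1)}. *)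
Definition rpow_abs (x p : R) : R :=
  if Req_EM_T x 0 then 0 else Rpower (Rabs x) p.

Definition pexp (d : nat) : R := 2 * (INR d + 1) / (INR d - 1).

Definition Xphi (d : nat) (kap l lam k mu A phi : R) : R :=
  INR d * (INR d - 1) / (kap ^ 2 * l ^ 2) * mu * exp (- (INR d + 1) * A)
  + k * ((INR d - 1) / (2 * l)) ^ 2 * phi ^ 2 * exp (-2 * A)
  + lam * rpow_abs phi (pexp d).

Definition XA (d : nat) (k mu A : R) : R :=
  1 + k * exp (-2 * A) + mu * exp (- (INR d + 1) * A).

Definition dom (d : nat) (kap l lam k mu A phi : R) : Prop :=
  0 < Xphi d kap l lam k mu A phi /\ 0 < XA d k mu A.

(* s = +1 or -1 is the sign choice "±" *)
Definition pi_phi (d : nat) (kap l lam k mu s A phi : R) : R :=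
  s * exp (INR d * A) * sqrt (Xphi d kap l lam k mu A phi).

Definition pi_A (d : nat) (kap l lam k mu s A phi : R) : R :=
  - (INR d * (INR d - 1) / (kap ^ 2 * l)) * exp (INR d * A) * sqrt (XA d k mu A)
  + (INR d - 1) / 2 * phi * pi_phi d kap l lam k mu s A phi.

Definition Ham (d : nat) (kap l lam k A phi pA pphi : R) : R :=
  1 / 2 *
  ( exp (- INR d * A) *
      (pphi ^ 2 - kap ^ 2 / (INR d * (INR d - 1)) * (pA - (INR d - 1) / 2 * phi * pphi) ^ 2)
  + exp (INR d * A) *
      (INR d * (INR d - 1) / (kap ^ 2 * l ^ 2) - lam * rpow_abs phi (pexp d)
       + INR d * (INR d - 1) * k / (kap ^ 2 * l ^ 2) * exp (-2 * A)
         * (1 - (INR d - 1) * kap ^ 2 / (4 * INR d) * phi ^ 2))).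

(* Main.v *)
Require Import Defs.
From Stdlib Require Import Reals Lra Psatz.
From Coquelicot Require Import Coquelicot.
Open Scope R_scope.

(* With alpha = (d-1)/2, part (i) is algebra: pi_A - alpha phi pi_phi is the pure gravity
   momentum, and after squaring the Hamiltonian is a rational identity in the two radicands.
   Everything else rests on the dilation A -> A + t, phi -> phi e^(-alpha t): since
   2(d+1)/(d-1) is the conformal weight of the potential, the scalar radicand only picks up
   the factor e^(-(d+1)t).  Hence pi_phi(A, phi) = e^(alpha A) P(phi e^(alpha A)) with
   P = pi_phi(0, .), and pi_A(A, phi) = pi_A(A, 0) + alpha phi pi_phi(A, phi).  The chain
   rule then gives the symmetry of the mixed partials, and shows that
   S(A, phi) = int_0^A pi_A(a, 0) da + int_0^(phi e^(alpha A)) P has gradient (pi_A, pi_phi). *)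

Lemma rpow_abs_0 q : rpow_abs 0 q = 0.
Proof. unfold rpow_abs; destruct (Req_EM_T 0 0); [reflexivity | contradiction]. Qed.

Lemma rpow_abs_neq0 x q : x <> 0 -> rpow_abs x q = exp (q * ln (Rabs x)).
Proof. intros Hx; unfold rpow_abs; destruct (Req_EM_T x 0); [contradiction | reflexivity]. Qed.

Lemma rpow_abs_mul_exp x q t : rpow_abs (x * exp t) q = rpow_abs x q * exp (q * t).
Proof.
  destruct (Req_dec x 0) as [-> | Hx]; [rewrite Rmult_0_l, !rpow_abs_0; ring |].
  assert (Hxt : x * exp t <> 0)
    by (apply Rmult_integral_contrapositive; split; [exact Hx | apply exp_neq_0]).
  rewrite !rpow_abs_neq0, <- exp_plus by assumption; f_equal.
  rewrite Rabs_mult, (Rabs_pos_eq (exp t)) by (left; apply exp_pos).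
  rewrite ln_mult, ln_exp by (try apply Rabs_pos_lt; auto using exp_pos); ring.
Qed.

(* For [|h| < 1] and [q >= 2], [|h|^q / |h| = |h|^(q-1) <= |h|]. *)
Lemma is_derive_rpow_abs_0 q : 2 <= q -> is_derive (fun y => rpow_abs y q) 0 0.
Proof.
  intros Hq; apply is_derive_Reals; intros eps Heps.
  exists (mkposreal _ (Rmin_pos 1 eps Rlt_0_1 Heps)); intros h Hh Hlt; simpl in Hlt.
  assert (Hh1 : Rabs h < 1) by (eapply Rlt_le_trans; [exact Hlt | apply Rmin_l]).
  assert (Hheps : Rabs h < eps) by (eapply Rlt_le_trans; [exact Hlt | apply Rmin_r]).
  assert (Hpos : 0 < Rabs h) by (apply Rabs_pos_lt; exact Hh).
  assert (Hln : ln (Rabs h) < 0) by (rewrite <- ln_1; apply ln_increasing; assumption).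
  rewrite Rplus_0_l, rpow_abs_0, rpow_abs_neq0 by exact Hh.
  replace ((exp (q * ln (Rabs h)) - 0) / h - 0) with (exp ((q - 1) * ln (Rabs h)) * (Rabs h / h))
    by (replace (q * ln (Rabs h)) with ((q - 1) * ln (Rabs h) + ln (Rabs h)) by ring;
        rewrite exp_plus, exp_ln by exact Hpos; field; exact Hh).
  rewrite Rabs_mult, Rabs_div, Rabs_Rabsolu, Rabs_pos_eq by (auto using Rlt_le, exp_pos).
  unfold Rdiv; rewrite Rinv_r, Rmult_1_r by lra.
  apply Rle_lt_trans with (exp (ln (Rabs h))); [| rewrite exp_ln; assumption].
  assert (Hle : (q - 1) * ln (Rabs h) <= ln (Rabs h)) by nra.
  destruct Hle as [Hle | Heq];
    [left; apply exp_increasing; exact Hle | rewrite Heq; right; reflexivity].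
Qed.

Lemma ex_derive_rpow_abs q x : 2 <= q -> ex_derive (fun y => rpow_abs y q) x.
Proof.
  intros Hq; destruct (Req_dec x 0) as [-> | Hx].
  - eexists; exact (is_derive_rpow_abs_0 q Hq).
  - assert (Hpos : 0 < Rabs x) by (apply Rabs_pos_lt; exact Hx).
    apply ex_derive_ext_loc with (f := fun y => exp (q / 2 * ln (y * y))).
    + exists (mkposreal _ Hpos); intros y Hy.
      assert (Hy0 : y <> 0).
      { intros ->; unfold ball in Hy; simpl in Hy.
        unfold AbsRing_ball, abs, minus, plus, opp in Hy; simpl in Hy.
        rewrite Rplus_0_l, Rabs_Ropp in Hy; lra. }
      rewrite rpow_abs_neq0 by exact Hy0; f_equal.
      rewrite <- (Rabs_pos_eq (y * y)), Rabs_mult, ln_mult by (try apply Rabs_pos_lt; nra); field.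
    + assert (0 < x * x) by nra; auto_derive; assumption.
Qed.

Lemma continuous_comp_fst (f : R -> R) (z : R * R) :
  ex_derive f (fst z) -> continuous (fun y : R * R => f (fst y)) z.
Proof.
  destruct z; intros Hf; apply continuous_comp; [apply continuous_fst |].
  exact (ex_derive_continuous f _ Hf).
Qed.

Lemma continuous_comp_snd (f : R -> R) (z : R * R) :
  ex_derive f (snd z) -> continuous (fun y : R * R => f (snd y)) z.
Proof.
  destruct z; intros Hf; apply continuous_comp; [apply continuous_snd |].
  exact (ex_derive_continuous f _ Hf).
Qed.

Lemma continuous_Rplus {U : UniformSpace} (f g : U -> R) z :
  continuous f z -> continuous g z -> continuous (fun y => f y + g y) z.
Proof. exact (continuous_plus f g z). Qed.

Lemma continuous_Rmult {U : UniformSpace} (f g : U -> R) z :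
  continuous f z -> continuous g z -> continuous (fun y => f y * g y) z.
Proof. exact (@continuous_mult U R_AbsRing f g z). Qed.

Lemma continuous_mul_sqrt (g f : R -> R) x :
  ex_derive g x -> ex_derive f x -> continuous (fun y => g y * sqrt (f y)) x.
Proof.
  intros Hg Hf.
  apply continuous_Rmult; [exact (ex_derive_continuous g x Hg) |].
  apply (@continuous_comp R_UniformSpace R_UniformSpace R_UniformSpace f sqrt);
    [exact (ex_derive_continuous f x Hf) | apply continuous_sqrt].
Qed.

Lemma ex_RInt_continuous_everywhere (f : R -> R) a b :
  (forall x, continuous f x) -> ex_RInt f a b.
Proof. intros Hf; apply (@ex_RInt_continuous R_CompleteNormedModule); intros; apply Hf. Qed.

Lemma locally_continuity_pt (f : R -> R) x :
  (forall y, continuous f y) -> locally x (fun y => continuity_pt f y).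
Proof. intros Hf; apply filter_forall; intros y; apply continuity_pt_filterlim, Hf. Qed.

Definition alpha (d : nat) : R := (INR d - 1) / 2.

Lemma pexp_mul_alpha d : (2 <= d)%nat -> pexp d * alpha d = INR d + 1.
Proof. intros Hd; apply le_INR in Hd; simpl in Hd; unfold pexp, alpha; field; lra. Qed.

Lemma pexp_ge_2 d : (2 <= d)%nat -> 2 <= pexp d.
Proof.
  intros Hd; apply le_INR in Hd; simpl in Hd; unfold pexp.
  apply Rmult_le_reg_r with (INR d - 1); [lra |].
  unfold Rdiv; rewrite Rmult_assoc, Rinv_l by lra; lra.
Qed.

Section Radial.

Variables (d : nat) (kap l lam k mu s : R).
Hypotheses (Hd : (2 <= d)%nat) (Hkap : 0 < kap) (Hl : 0 < l).

Local Notation Xp := (Xphi d kap l lam k mu).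
Local Notation pA := (pi_A d kap l lam k mu s).
Local Notation pphi := (pi_phi d kap l lam k mu s).

Lemma Ham_pi_eq_0 A phi : s ^ 2 = 1 ->
  0 <= Xp A phi -> 0 <= XA d k mu A ->
  Ham d kap l lam k A phi (pA A phi) (pphi A phi) = 0.
Proof.
  intros Hs HX HA; pose proof (le_INR _ _ Hd) as Hd'; simpl in Hd'.
  assert (Hexp : exp (- INR d * A) = / exp (INR d * A)).
  { rewrite <- exp_Ropp; f_equal; ring. }
  unfold Ham, pi_A, pi_phi; rewrite Hexp.
  match goal with |- context [(?t + ?a * ?b - ?a * ?b) ^ 2] =>
    replace (t + a * b - a * b) with t by ring end.
  rewrite !Rpow_mult_distr, !pow2_sqrt, Hs by assumption.
  unfold Xphi, XA; field; repeat split; try lra; apply exp_neq_0.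
Qed.

Lemma ex_derive_Xphi_phi A phi : ex_derive (Xp A) phi.
Proof.
  pose proof (ex_derive_rpow_abs (pexp d) phi (pexp_ge_2 d Hd)).
  unfold Xphi; auto_derive; auto.
Qed.

Lemma continuous_Xphi z : continuous (fun y : R * R => Xp (fst y) (snd y)) z.
Proof.
  unfold Xphi; apply continuous_Rplus; [apply continuous_Rplus |].
  - apply (continuous_comp_fst
      (fun a => INR d * (INR d - 1) / (kap ^ 2 * l ^ 2) * mu * exp (- (INR d + 1) * a))).
    auto_derive; auto.
  - apply continuous_Rmult.
    + apply (continuous_comp_snd (fun p => k * ((INR d - 1) / (2 * l)) ^ 2 * p ^ 2)).
      auto_derive; auto.
    + apply (continuous_comp_fst (fun a => exp (-2 * a))); auto_derive; auto.
  - apply (continuous_comp_snd (fun p => lam * rpow_abs p (pexp d))).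
    pose proof (ex_derive_rpow_abs (pexp d) (snd z) (pexp_ge_2 d Hd)); auto_derive; auto.
Qed.

Lemma continuous_XA z : continuous (fun y : R * R => XA d k mu (fst y)) z.
Proof. apply continuous_comp_fst; unfold XA; auto_derive; auto. Qed.

Lemma dom_neighbourhood A0 phi0 : dom d kap l lam k mu A0 phi0 ->
  exists eps, 0 < eps /\ forall A phi, Rabs (A - A0) < eps -> Rabs (phi - phi0) < eps ->
    dom d kap l lam k mu A phi.
Proof.
  intros [HX HA].
  pose proof (continuous_Xphi (A0, phi0) _ (open_gt 0 _ HX)) as LX.
  pose proof (continuous_XA (A0, phi0) _ (open_gt 0 _ HA)) as LA.
  unfold filtermap in LX, LA; destruct (filter_and _ _ LX LA) as [eps Heps].
  exists eps; split; [apply cond_pos |].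
  intros A phi HA' Hphi'; apply (Heps (A, phi)); split; assumption.
Qed.

Lemma Xphi_scaling A phi :
  Xp A phi
  = exp (- (INR d + 1) * A) * Xp 0 (phi * exp (alpha d * A)).
Proof.
  unfold Xphi; rewrite rpow_abs_mul_exp, !Rmult_0_r, exp_0.
  replace (pexp d * (alpha d * A)) with ((INR d + 1) * A)
    by (rewrite <- (pexp_mul_alpha d Hd); ring).
  assert (Hsq : exp (-2 * A) = exp (- (INR d + 1) * A) * exp (alpha d * A) ^ 2).
  { simpl; rewrite Rmult_1_r, <- !exp_plus; f_equal; unfold alpha; field. }
  assert (Hinv : exp (- (INR d + 1) * A) * exp ((INR d + 1) * A) = 1).
  { rewrite <- exp_plus, <- exp_0; f_equal; ring. }
  rewrite Hsq; transitivity
    (INR d * (INR d - 1) / (kap ^ 2 * l ^ 2) * mu * exp (- (INR d + 1) * A)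
     + k * ((INR d - 1) / (2 * l)) ^ 2 * phi ^ 2 * (exp (- (INR d + 1) * A) * exp (alpha d * A) ^ 2)
     + lam * rpow_abs phi (pexp d) * (exp (- (INR d + 1) * A) * exp ((INR d + 1) * A)));
    [rewrite Hinv |]; ring.
Qed.

Lemma pi_phi_scaling A phi :
  pphi A phi = exp (alpha d * A) * pphi 0 (phi * exp (alpha d * A)).
Proof.
  unfold pi_phi; rewrite Xphi_scaling, sqrt_mult_alt by (left; apply exp_pos).
  replace (exp (- (INR d + 1) * A)) with (exp (- (INR d + 1) / 2 * A) * exp (- (INR d + 1) / 2 * A))
    by (rewrite <- exp_plus; f_equal; field).
  rewrite sqrt_square by (left; apply exp_pos).
  replace (exp (alpha d * A)) with (exp (INR d * A) * exp (- (INR d + 1) / 2 * A))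
    by (rewrite <- exp_plus; f_equal; unfold alpha; field).
  rewrite Rmult_0_r, exp_0; ring.
Qed.

Lemma pi_A_split A phi :
  pA A phi = pA A 0 + alpha d * phi * pphi A phi.
Proof. unfold pi_A, alpha; ring. Qed.

Lemma ex_derive_pi_phi_slice u : 0 < Xp 0 u ->
  ex_derive (pphi 0) u.
Proof.
  intros Hpos; pose proof (ex_derive_Xphi_phi 0 u).
  unfold pi_phi; auto_derive; auto.
Qed.

(* Both partials equal [alpha e (P u + u P'(u))], where [e = exp (alpha A)] and [u = phi e]. *)
Lemma pi_mixed_partials A phi : 0 < Xp A phi ->
  exists v,
    is_derive (fun p => pA A p) phi v /\
    is_derive (fun a => pphi a phi) A v.
Proof.
  intros Hpos.
  set (P := pphi 0).
  set (u := phi * exp (alpha d * A)).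
  assert (HP : ex_derive P u).
  { apply ex_derive_pi_phi_slice.
    rewrite Xphi_scaling in Hpos; apply Rmult_lt_reg_l with (exp (- (INR d + 1) * A));
      [apply exp_pos | rewrite Rmult_0_r; exact Hpos]. }
  exists (alpha d * exp (alpha d * A) * (P u + u * Derive P u)); split.
  - apply is_derive_ext with
      (fun p => pA A 0 + alpha d * p * (exp (alpha d * A) * P (p * exp (alpha d * A)))).
    { intros p; rewrite (pi_A_split A p), (pi_phi_scaling A p); reflexivity. }
    auto_derive; [exact HP | change (fun x => P x) with P; unfold u; ring].
  - apply is_derive_ext with (fun a => exp (alpha d * a) * P (phi * exp (alpha d * a))).
    { intros a; rewrite (pi_phi_scaling a phi); reflexivity. }
    auto_derive; [exact HP | change (fun x => P x) with P; unfold u; ring].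
Qed.

Lemma continuous_pi_phi_slice u : continuous (pphi 0) u.
Proof.
  apply (continuous_mul_sqrt (fun _ => s * exp (INR d * 0)) (Xp 0));
    [auto_derive; auto | apply ex_derive_Xphi_phi].
Qed.

Lemma continuous_pi_A_axis a : continuous (fun a => pA a 0) a.
Proof.
  apply continuous_ext with
    (f := fun a => - (INR d * (INR d - 1) / (kap ^ 2 * l)) * exp (INR d * a) * sqrt (XA d k mu a));
    [intros x; unfold pi_A; rewrite Rmult_0_r, Rmult_0_l, Rplus_0_r; reflexivity |].
  apply continuous_mul_sqrt; unfold XA; auto_derive; auto.
Qed.

Definition principal_function (A phi : R) : R :=
  RInt (fun a => pA a 0) 0 A
  + RInt (pphi 0) 0 (phi * exp (alpha d * A)).

Lemma is_derive_principal_function_A A phi :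
  is_derive (fun a => principal_function a phi) A (pA A phi).
Proof.
  unfold principal_function; auto_derive.
  - repeat split; auto using ex_RInt_continuous_everywhere, locally_continuity_pt,
      continuous_pi_A_axis, continuous_pi_phi_slice.
  - rewrite (pi_A_split A phi), (pi_phi_scaling A phi); ring.
Qed.

Lemma is_derive_principal_function_phi A phi :
  is_derive (fun p => principal_function A p) phi (pphi A phi).
Proof.
  unfold principal_function; auto_derive.
  - repeat split; auto using ex_RInt_continuous_everywhere, locally_continuity_pt,
      continuous_pi_phi_slice.
  - rewrite (pi_phi_scaling A phi); ring.
Qed.

End Radial.

Theorem mainTheorem9 :
  forall (d : nat) (kap l lam k mu s : R),
    (2 <= d)%nat -> 0 < kap -> 0 < l ->
    (k = -1 \/ k = 0 \/ k = 1) ->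
    (s = 1 \/ s = -1) ->
    (forall A phi, dom d kap l lam k mu A phi ->
       Ham d kap l lam k A phi (pi_A d kap l lam k mu s A phi)
                               (pi_phi d kap l lam k mu s A phi) = 0)
    /\
    (forall A phi, dom d kap l lam k mu A phi ->
       exists v : R,
         is_derive (fun p => pi_A d kap l lam k mu s A p) phi v /\
         is_derive (fun a => pi_phi d kap l lam k mu s a phi) A v)
    /\
    (forall A0 phi0, dom d kap l lam k mu A0 phi0 ->
       exists eps : R, 0 < eps /\
       exists S : R -> R -> R,
         forall A phi, Rabs (A - A0) < eps -> Rabs (phi - phi0) < eps ->
           dom d kap l lam k mu A phi /\
           is_derive (fun a => S a phi) A (pi_A d kap l lam k mu s A phi) /\
           is_derive (fun p => S A p) phi (pi_phi d kap l lam k mu s A phi) /\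
           Ham d kap l lam k A phi (Derive (fun a => S a phi) A)
                                   (Derive (fun p => S A p) phi) = 0).
Proof.
  intros d kap l lam k mu s Hd Hkap Hl _ Hs.
  assert (Hs2 : s ^ 2 = 1) by (destruct Hs; subst; ring).
  assert (Hshell : forall A phi, dom d kap l lam k mu A phi ->
    Ham d kap l lam k A phi (pi_A d kap l lam k mu s A phi) (pi_phi d kap l lam k mu s A phi) = 0).
  { intros A phi [HX HA]; apply Ham_pi_eq_0; auto; lra. }
  split; [exact Hshell | split].
  - intros A phi [HX _]; apply pi_mixed_partials; assumption.
  - intros A0 phi0 Hdom.
    destruct (dom_neighbourhood d kap l lam k mu Hd A0 phi0 Hdom) as [eps [Heps Hnear]].
    exists eps; split; [exact Heps |]; exists (principal_function d kap l lam k mu s).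
    intros A phi HA Hphi; pose proof (Hnear A phi HA Hphi) as Hnear_dom.
    pose proof (is_derive_principal_function_A d kap l lam k mu s Hd A phi) as DA.
    pose proof (is_derive_principal_function_phi d kap l lam k mu s Hd A phi) as Dphi.
    split; [exact Hnear_dom | split; [exact DA | split; [exact Dphi |]]].
    replace (Derive (fun a => principal_function d kap l lam k mu s a phi) A)
      with (pi_A d kap l lam k mu s A phi) by (symmetry; exact (is_derive_unique _ _ _ DA)).
    replace (Derive (fun p => principal_function d kap l lam k mu s A p) phi)
      with (pi_phi d kap l lam k mu s A phi) by (symmetry; exact (is_derive_unique _ _ _ Dphi)).
    exact (Hshell A phi Hnear_dom).
Qed.
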